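(* Let $(\Omega,\mathcal{H},\mathbb{E})$ be a sub-linear expectation space and let $\{X_n;n\geq 1\}$ be a sequence of independent random variables in it. Suppose $\{a_n\}$ is a sequence of real numbers such that $1\leq a_n\nearrow\infty$ and $$\sum_{n=1}^{\infty}\frac{\mathbb{E}[X_n^2]}{a_n^2}<\infty.$$ Denote $S_n=\sum_{i=1}^nX_i$. Then $$\widehat{\mathbb{V}}^*\left(\limsup_{n\rightarrow\infty}\frac{S_n-\mathbb{E}[S_n]}{a_n}>0\ \text{ or }\ \liminf_{n\rightarrow\infty}\frac{S_n-\hat{\mathcal{E}}[S_n]}{a_n}<0\right)=0.$$
   Context: A sub-linear expectation space $(\Omega,\mathcal{H},\mathbb{E})$: $(\Omega,\mathcal{F})$ is a measurable space, $\mathcal{H}$ is a linear space of real functions on $\Omega$ such that $\varphi(X_1,\dots,X_n)\in\mathcal{H}$ whenever $X_1,\dots,X_n\in\mathcal{H}$ and $\varphi$ is locally Lipschitz with $|\varphi(x)-\varphi(y)|\le C(1+|x|^m+|y|^m)|x-y|$; elements of $\mathcal{H}$ are called random variables. $\mathbb{E}:\mathcal{H}\to[-\infty,\infty]$ is monotone, constant preserving, sub-additive ($\mathbb{E}[X+Y]\le\mathbb{E}[X]+\mathbb{E}[Y]$ when the right side is defined) and positively homogeneous. The conjugate (lower) expectation is $\hat{\mathcal{E}}[X]=-\mathbb{E}[-X]$. Independence: a random vector $Y$ is independent of a random vector $X$ if $\mathbb{E}[\varphi(X,Y)]=\mathbb{E}\big[\mathbb{E}[\varphi(x,Y)]|_{x=X}\big]$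 for every bounded Lipschitz $\varphi$; a sequence $\{X_n\}$ is independent if $X_{i+1}$ is independent of $(X_1,\dots,X_i)$ for each $i\ge1$. Capacities: $\widehat{\mathbb{V}}(A)=\inf\{\mathbb{E}[\xi]: I_A\le\xi,\ \xi\in\mathcal{H}\}$ for $A\in\mathcal{F}$, and its countably sub-additive extension $\widehat{\mathbb{V}}^*(A)=\inf\{\sum_{n=1}^\infty\widehat{\mathbb{V}}(A_n): A\subset\bigcup_{n=1}^\infty A_n\}$.
   Formalization: Each random variable X_n is assumed measurable with respect to the sigma-field F, which the English leaves implicit; without this the claim can fail, since the sets covering the event must lie in F. *)

(* Defs.v *)
From HB Require Import structures.
From mathcomp Require Import all_boot all_order all_algebra.
From mathcomp Require Import all_classical all_reals all_analysis.
Set Implicit Arguments. Unset Strict Implicit. Unset Printing Implicit Defensive.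
Import Order.TTheory GRing.Theory Num.Theory.
Import numFieldNormedType.Exports.
Local Open Scope classical_set_scope.
Local Open Scope ring_scope.

Section SublinearDefs.
Variables (R : realType) (Omega : Type).

(* phi : R^n -> R with |phi x - phi y| <= C (1 + |x|^m + |y|^m) |x - y|
   (norm on 'rV_n is the max norm; all norms on R^n are equivalent). *)
Definition loc_lipschitz (n : nat) (phi : 'rV[R]_n -> R) : Prop :=
  exists (C : R) (m : nat), forall x y : 'rV[R]_n,
    `|phi x - phi y| <= C * (1 + `|x| ^+ m + `|y| ^+ m) * `|x - y|.

Definition rv_space (H : set (Omega -> R)) : Prop :=
  [/\ H (fun _ => 0),
      (forall X Y, H X -> H Y -> H (X \+ Y)),
      (forall (c : R) X, H X -> H (fun w => c * X w)) &
      (forall (n : nat) (Xs : 'I_n -> Omega -> R) (phi : 'rV[R]_n -> R),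
          (forall i, H (Xs i)) -> loc_lipschitz phi ->
          H (fun w => phi (\row_i Xs i w)))].

(* E : H -> [-oo, +oo] monotone, constant preserving, sub-additive
   (when the right-hand side is defined), positively homogeneous. *)
Definition sublinear_expectation (H : set (Omega -> R))
    (E : (Omega -> R) -> \bar R) : Prop :=
  [/\ (forall X Y, H X -> H Y -> (forall w, (X w <= Y w)%R) -> (E X <= E Y)%E),
      (forall c : R, E (fun _ => c) = c%:E),
      (forall X Y, H X -> H Y ->
          ~ (E X = +oo%E /\ E Y = -oo%E) -> ~ (E X = -oo%E /\ E Y = +oo%E) ->
          (E (X \+ Y)%R <= E X + E Y)%E) &
      (forall (l : R) X, H X -> 0 < l -> E (fun w => l * X w) = (l%:E * E X)%E)].

Definition sublinear_expectation_space (H : set (Omega -> R))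
    (E : (Omega -> R) -> \bar R) : Prop :=
  rv_space H /\ sublinear_expectation H E.

Definition bounded_lipschitz2 (n : nat) (phi : 'rV[R]_n -> R -> R) : Prop :=
  (exists M : R, forall x y, `|phi x y| <= M) /\
  (exists L : R, forall x x' y y',
      `|phi x y - phi x' y'| <= L * (`|x - x'| + `|y - y'|)).

Definition indep_of (E : (Omega -> R) -> \bar R) (n : nat)
    (X : Omega -> 'rV[R]_n) (Y : Omega -> R) : Prop :=
  forall phi : 'rV[R]_n -> R -> R, bounded_lipschitz2 phi ->
    E (fun w => phi (X w) (Y w)) =
    E (fun w => fine (E (fun w' => phi (X w) (Y w')))).

Definition indep_seq (E : (Omega -> R) -> \bar R) (X : nat -> Omega -> R) : Prop :=
  forall i : nat, (1 <= i)%N ->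
    indep_of E (fun w => \row_(j < i) X j.+1 w) (X i.+1).

End SublinearDefs.

Section Capacities.
Variables (R : realType) (d : measure_display) (Omega : measurableType d).
Variables (H : set (Omega -> R)) (E : (Omega -> R) -> \bar R).

Definition Vhat (A : set Omega) : \bar R :=
  ereal_inf [set E xi | xi in [set xi | H xi /\ forall w, (\1_A w <= xi w)%R]].

Definition Vstar (A : set Omega) : \bar R :=
  ereal_inf [set (\sum_(0 <= n <oo) Vhat (B n))%E | B in
    [set B : nat -> set Omega | (forall n, measurable (B n)) /\
                                 A `<=` \bigcup_n B n]].
End Capacities.

(* Main.v *)
(** Since [Vhat] and [Vstar] need not be continuous from below, the maximal
    inequality is used on finite blocks only, and it has to be one-sided because
    the centred partial sums may drift to minus infinity.  Put
    [eta_j = (X_j - E X_j) / a_j], let [M] be the walk with steps [eta_j]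
    reflected at 0 and started at [m].  By induction
    [sum_(m <= j <= n) a_j eta_j <= a_n M_n], which replaces Kronecker's lemma, so
    it is enough that [M] is eventually small.  Clamping [X_j] at [a_j] costs
    [E X_j^2 / a_j^2] both in capacity and (after division by [a_j]) in mean.  For
    clamped increments [xi] with [E xi = 0], [M^2] minus the sum of the variances
    is a supermartingale, because [((M + xi)^+)^2 <= M^2 + 2 M xi + xi^2] and
    [M >= 0]; a Lipschitz cutoff turns this into a bound on the capacity of
    [max M >= eps].  Blocks whose tail variance decays like [8^-k] then have
    exceedance capacities [2^-k], and Borel-Cantelli applies; reflected walks
    restarted at the block ends add up.  Finally [E S_n = sum E X_i] follows from
    independence by truncation, and the lower limit is the same statement for
    [-X]. *)

Require Import Defs.
From HB Require Import structures.
From mathcomp Require Import all_boot all_order all_algebra.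
From mathcomp Require Import all_classical all_reals all_analysis.
From mathcomp Require Import measurable_realfun zify ring lra.
Import Order.TTheory GRing.Theory Num.Theory.
Import numFieldNormedType.Exports.
Local Open Scope classical_set_scope.
Local Open Scope ring_scope.

(** * Sub-linear expectations of real random variables *)

Section ExpectationTheory.
Context {R : realType} {Omega : Type}.
Context {H : set (Omega -> R)} {E : (Omega -> R) -> \bar R}.
Hypothesis hE : sublinear_expectation_space H E.

Local Notation e X := (fine (E X)).

(** Finiteness of [E |X|] makes [E X] real, so that [fine] loses nothing and sub-additivity holds
    without side conditions. *)
Definition integrable_rv (X : Omega -> R) : Prop :=
  H X /\ (E (fun w => `|X w|%R) < +oo)%E.

Lemma rv_add X Y : H X -> H Y -> H (fun w => X w + Y w).
Proof. by case: hE => -[_ h _ _] _; exact: h. Qed.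

Lemma rv_scale c X : H X -> H (fun w => c * X w).
Proof. by case: hE => -[_ _ h _] _; exact: h. Qed.

Lemma rv_comp (g : R -> R) X (C : R) (m : nat) : H X ->
  (forall x y, `|g x - g y| <= C * (1 + `|x| ^+ m + `|y| ^+ m) * `|x - y|) ->
  H (fun w => g (X w)).
Proof.
move=> HX hg; case: hE => -[_ _ _ h] _.
have normE (x : 'rV[R]_1) : `|x| = `|x 0 0|.
  rewrite -[LHS]/(mx_norm x) mx_normrE; apply/le_anti/andP; split.
    by apply: bigmax_le => // -[i j] _ /=; rewrite !ord1.
  by apply: (le_bigmax _ (fun ij => `|x ij.1 ij.2|) (0, 0)).
have := h 1%N (fun _ => X) (fun v => g (v 0 0)) (fun _ => HX).
have -> : (fun w => g ((\row__ X w : 'rV[R]_1) 0 0)) = (fun w => g (X w)).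
  by apply/funext => w; rewrite mxE.
by apply; exists C, m => x y; rewrite !normE !mxE.
Qed.

Lemma rv_lipschitz (g : R -> R) X (L : R) : H X ->
  (forall x y, `|g x - g y| <= L * `|x - y|) -> H (fun w => g (X w)).
Proof.
(* With exponent 0 the weight [1 + |x|^0 + |y|^0] equals 3. *)
move=> HX hg; apply: (@rv_comp g X (L / 3) 0) => // x y.
by apply: (le_trans (hg x y)); rewrite !expr0; lra.
Qed.

Lemma rv_abs X : H X -> H (fun w => `|X w|).
Proof.
move=> HX; apply: (rv_lipschitz (fun x => `|x|) X 1) => // x y.
by rewrite mul1r ler_dist_dist.
Qed.

Lemma rv_sqr X : H X -> H (fun w => X w ^+ 2).
Proof.
move=> HX; apply: (@rv_comp (fun x => x ^+ 2) X 1 1) => // x y.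
rewrite !expr1 subr_sqr normrM mulrC ler_wpM2r //.
by have := ler_normD x y; lra.
Qed.

Lemma rv_cst (c : R) : H (fun _ => c).
Proof.
case: hE => -[h _ _ _] _; apply: (rv_lipschitz (fun _ => c) _ 0 h) => x y.
by rewrite subrr normr0 mul0r.
Qed.

Lemma E_le X Y : H X -> H Y -> (forall w, X w <= Y w) -> (E X <= E Y)%E.
Proof. by case: hE => _ [h _ _ _]; exact: h. Qed.

Lemma E_cst c : E (fun _ => c) = c%:E.
Proof. by case: hE => _ [_ h _ _]; exact: h. Qed.

Lemma integrable_rvP X : integrable_rv X -> H X.
Proof. by case. Qed.

(** Domination by [|X|] keeps both [E X] and [E (-X)] below [+oo]; the value [-oo] is then excluded
    by [0 = E 0 <= E X + E (-X)]. *)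
Lemma integrable_fin X : integrable_rv X -> E X = (e X)%:E.
Proof.
move=> [HX fX]; rewrite fineK //.
have HN : H (fun w => - X w).
  by have := rv_scale (-1) _ HX; under eq_fun do rewrite mulN1r.
have lt1 : (E X < +oo)%E.
  apply: le_lt_trans fX; apply: E_le => //; first exact: rv_abs.
  by move=> w; exact: ler_norm.
have lt2 : (E (fun w => (- X w)%R) < +oo)%E.
  apply: le_lt_trans fX; apply: E_le => //; first exact: rv_abs.
  by move=> w; rewrite -normrN ler_norm.
have [_ [_ _ hadd _]] := hE.
have := hadd X (fun w => - X w) HX HN.
have -> : (X \+ (fun w => - X w)) = (fun _ => 0).
  by apply/funext => w /=; rewrite subrr.
rewrite E_cst.
move: lt1 lt2; case: (E X) => [x| |] //; case: (E (fun w => - X w)) => [y| |] //= _ _.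
- by move=> h; have := h ltac:(by case) ltac:(by case).
- by move=> h; have := h ltac:(by case) ltac:(by case).
Qed.

Lemma integrable_dom X Y : H X -> integrable_rv Y ->
  (forall w, `|X w| <= Y w) -> integrable_rv X.
Proof.
move=> HX [HY fY] XY; split=> //; apply: le_lt_trans fY.
apply: E_le => [||w]; try exact: rv_abs.
by apply: le_trans (XY w) (ler_norm _).
Qed.

Lemma integrable_nonneg X : H X -> (forall w, 0 <= X w) -> (E X < +oo)%E ->
  integrable_rv X.
Proof.
move=> HX X0 fX; split=> //.
by have -> : (fun w => `|X w|) = X by apply/funext => w; rewrite ger0_norm.
Qed.

Lemma integrable_cst c : integrable_rv (fun _ => c).
Proof. by split; [exact: rv_cst|rewrite E_cst ltry]. Qed.

Lemma integrable_abs X : integrable_rv X -> integrable_rv (fun w => `|X w|).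
Proof.
move=> [HX fX]; split; first exact: rv_abs.
by under eq_fun do rewrite normr_id.
Qed.

Lemma integrable_bounded X M : H X -> (forall w, `|X w| <= M) -> integrable_rv X.
Proof. by move=> HX; exact: (integrable_dom _ _ HX (integrable_cst M)). Qed.

Lemma fine_E_le X Y : integrable_rv X -> integrable_rv Y ->
  (forall w, X w <= Y w) -> e X <= e Y.
Proof.
move=> iX iY XY; rewrite -lee_fin -!integrable_fin //.
by apply: E_le => //; apply: integrable_rvP.
Qed.

Lemma fine_E_cst c : e (fun _ => c) = c.
Proof. by rewrite E_cst. Qed.

Lemma integrable_add X Y : integrable_rv X -> integrable_rv Y ->
  integrable_rv (fun w => X w + Y w).
Proof.
move=> iX iY; have [HX _] := iX; have [HY _] := iY.
have HXY := rv_add _ _ HX HY; split=> //.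
have [fX fY] := (integrable_fin _ (integrable_abs _ iX),
                 integrable_fin _ (integrable_abs _ iY)).
have [_ [_ _ hadd _]] := hE.
apply: (@le_lt_trans _ _ (E ((fun w => `|X w|) \+ (fun w => `|Y w|)))).
  apply: E_le => [||w]; first exact: rv_abs.
    by apply: rv_add; exact: rv_abs.
  exact: ler_normD.
apply: le_lt_trans (hadd _ _ _ _ _ _) _; try exact: rv_abs.
- by rewrite fX => -[].
- by rewrite fX => -[].
- by rewrite fX fY -EFinD ltry.
Qed.

Lemma fine_E_add X Y : integrable_rv X -> integrable_rv Y ->
  e (fun w => X w + Y w) <= e X + e Y.
Proof.
move=> iX iY; have [HX _] := iX; have [HY _] := iY.
have [_ [_ _ hadd _]] := hE.
rewrite -lee_fin EFinD -!integrable_fin //; last exact: integrable_add.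
by apply: (hadd X Y) => //; rewrite (integrable_fin _ iX) => -[].
Qed.

Lemma fine_E_scale c X : 0 <= c -> integrable_rv X ->
  e (fun w => c * X w) = c * e X.
Proof.
rewrite le_eqVlt => /predU1P[<- _|c0 iX].
  by under eq_fun do rewrite mul0r; rewrite fine_E_cst mul0r.
have [HX _] := iX; have [_ [_ _ _ h]] := hE.
by rewrite h // (integrable_fin _ iX) -EFinM.
Qed.

Lemma integrable_scale c X : integrable_rv X -> integrable_rv (fun w => c * X w).
Proof.
move=> iX; have [HX _] := iX; split; first exact: rv_scale.
under eq_fun do rewrite normrM.
have [->|c0] := eqVneq c 0.
  by under eq_fun do rewrite normr0 mul0r; rewrite E_cst ltry.
have [_ [_ _ _ h]] := hE.
rewrite h ?normr_gt0 //; last exact: rv_abs.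
by rewrite (integrable_fin _ (integrable_abs _ iX)) -EFinM ltry.
Qed.

(** Sub-additivity gives one inequality and, applied to [X = (X + c) + (-c)], also the other. *)
Lemma fine_E_addc X c : integrable_rv X -> e (fun w => X w + c) = e X + c.
Proof.
move=> iX; apply/le_anti/andP; split.
  apply: le_trans (fine_E_add _ _ iX (integrable_cst c)) _.
  by rewrite fine_E_cst.
rewrite -lerBrDr -[- c]fine_E_cst.
apply: le_trans (fine_E_add _ _ _ (integrable_cst (- c))).
  apply: fine_E_le => //.
    by apply: integrable_add; [apply: integrable_add|]; try exact: integrable_cst.
  by move=> w; rewrite addrK.
by apply: integrable_add => //; exact: integrable_cst.
Qed.

Lemma integrable_sum n (X : nat -> Omega -> R) :
  (forall i, (i < n)%N -> integrable_rv (X i)) ->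
  integrable_rv (fun w => \sum_(i < n) X i w).
Proof.
elim: n => [|n IH] iX.
  by under eq_fun do rewrite big_ord0; exact: integrable_cst.
under eq_fun do rewrite big_ord_recr /=.
apply: integrable_add; last exact: iX.
by apply: IH => i lin; apply: iX; exact: ltnW.
Qed.

Lemma fine_E_sum n (X : nat -> Omega -> R) :
  (forall i, (i < n)%N -> integrable_rv (X i)) ->
  e (fun w => \sum_(i < n) X i w) <= \sum_(i < n) e (X i).
Proof.
elim: n => [|n IH] iX.
  by under eq_fun do rewrite big_ord0; rewrite fine_E_cst big_ord0.
have iX' i : (i < n)%N -> integrable_rv (X i) by move=> lin; apply/iX/ltnW.
under eq_fun do rewrite big_ord_recr /=.
rewrite big_ord_recr /=; apply: le_trans (fine_E_add _ _ _ _) _.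
- exact: integrable_sum.
- exact: iX.
- by rewrite lerD2r; exact: IH.
Qed.

(** The one-sided substitute for linearity by which truncation errors in mean are estimated. *)
Lemma fine_E_le_dist X Y Z : integrable_rv X -> integrable_rv Y ->
  integrable_rv Z -> (forall w, `|X w - Y w| <= Z w) -> e X <= e Y + e Z.
Proof.
move=> iX iY iZ XYZ; apply: le_trans (fine_E_add _ _ iY iZ).
apply: fine_E_le => //; first exact: integrable_add.
by move=> w; have := le_trans (ler_norm _) (XYZ w); rewrite lerBlDl.
Qed.

Lemma fine_E_norm_le X M : H X -> (forall w, `|X w| <= M) -> `|e X| <= M.
Proof.
move=> HX XM; have iX := integrable_bounded _ _ HX XM.
rewrite ler_norml -{1}(fine_E_cst (- M)) -{2}(fine_E_cst M).
apply/andP; split; apply: fine_E_le => //; try exact: integrable_cst; move=> w;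
  by have := XM w; rewrite ler_norml => /andP[].
Qed.

Lemma integrable_of_sqr X : H X -> (E (fun w => (X w ^+ 2)%R) < +oo)%E ->
  integrable_rv X /\ integrable_rv (fun w => X w ^+ 2).
Proof.
move=> HX fX.
have i2 : integrable_rv (fun w => X w ^+ 2).
  by apply: integrable_nonneg => // [|w]; [exact: rv_sqr|exact: sqr_ge0].
split=> //.
apply: (integrable_dom _ _ HX (integrable_add _ _ i2 (integrable_cst 1))) => w.
by rewrite -[X w ^+ 2]real_normK ?num_real //; have := sqr_ge0 (`|X w| - 1); nra.
Qed.

(** The bound [2 s Y <= s^2 + Y^2] with [Y = X] and [s = e X] settles the case [e X >= 0]. If
    [e X < 0], take [Y = -X] and [s = - e X], and use [e (-X) >= - e X]. *)
Lemma sqr_fine_E_le X : integrable_rv X -> integrable_rv (fun w => X w ^+ 2) ->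
  e X ^+ 2 <= e (fun w => X w ^+ 2).
Proof.
move=> iX i2; set m := e X.
have key s Y : integrable_rv Y -> (forall w, Y w ^+ 2 = X w ^+ 2) -> 0 <= s ->
    2 * s * e Y <= s ^+ 2 + e (fun w => X w ^+ 2).
  move=> iY YX s0; rewrite -fine_E_scale ?mulr_ge0 // addrC -fine_E_addc //.
  apply: fine_E_le; first exact: integrable_scale.
    by apply: integrable_add => //; exact: integrable_cst.
  by move=> w; rewrite -YX; have := sqr_ge0 (Y w - s); nra.
have iN : integrable_rv (fun w => - X w).
  by have := integrable_scale (-1) _ iX; under eq_fun do rewrite mulN1r.
have mN : 0 <= m + e (fun w => - X w).
  apply: le_trans (fine_E_add _ _ iX iN).
  by under eq_fun do rewrite subrr; rewrite fine_E_cst.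
have [m0|m0] := leP 0 m.
  by have := key m X iX (fun _ => erefl) m0; rewrite -/m; nra.
have Nm0 : 0 <= - m by rewrite oppr_ge0 ltW.
have := key (- m) (fun w => - X w) iN (fun w => sqrrN (X w)) Nm0.
have := mulr_ge0 Nm0 mN; nra.
Qed.

End ExpectationTheory.

(** * Bounded Lipschitz functionals and independence *)

Section BoundedLipschitz.
Context {R : realType}.
Implicit Types (f g : (nat -> R) -> R) (x y : nat -> R).

(* Functionals of a whole sequence that depend only on its first [n] terms. *)
Definition blip (n : nat) f : Prop :=
  (exists M, forall x, `|f x| <= M) /\
  (exists2 L, 0 <= L & forall x y, `|f x - f y| <= L * \sum_(j < n) `|x j - y j|).

Definition lipschitz_fun (g : R -> R) : Prop :=
  exists2 L, 0 <= L & forall s t, `|g s - g t| <= L * `|s - t|.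

Lemma blip_cst n c : blip n (fun _ => c).
Proof.
split; first by exists `|c|.
by exists 0 => // x y; rewrite subrr normr0 mul0r.
Qed.

Lemma blip_add n f g : blip n f -> blip n g -> blip n (fun x => f x + g x).
Proof.
move=> [[M fM] [L L0 fL]] [[N gN] [K K0 gK]]; split.
  by exists (M + N) => x; apply: le_trans (ler_normD _ _) (lerD _ _).
exists (L + K) => [|x y]; first exact: addr_ge0.
rewrite mulrDl opprD addrACA; apply: le_trans (ler_normD _ _) (lerD _ _) => //.
Qed.

Lemma blip_mul n f g : blip n f -> blip n g -> blip n (fun x => f x * g x).
Proof.
move=> [[M fM] [L L0 fL]] [[N gN] [K K0 gK]].
have M0 : 0 <= M by exact: le_trans (normr_ge0 _) (fM (fun _ => 0)).
have N0 : 0 <= N by exact: le_trans (normr_ge0 _) (gN (fun _ => 0)).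
split.
  by exists (M * N) => x; rewrite normrM ler_pM.
exists (L * N + M * K) => [|x y]; first by rewrite addr_ge0 ?mulr_ge0.
have -> : f x * g x - f y * g y = (f x - f y) * g x + f y * (g x - g y) by ring.
apply: le_trans (ler_normD _ _) _; rewrite !normrM mulrDl; apply: lerD.
  by rewrite mulrAC; apply: ler_pM => //; exact: fL.
by rewrite -mulrA; apply: ler_pM => //; exact: gK.
Qed.

Lemma blip_comp n f (g : R -> R) : lipschitz_fun g -> blip n f ->
  blip n (fun x => g (f x)).
Proof.
move=> [K K0 gK] [[M fM] [L L0 fL]]; split.
  exists (`|g 0| + K * M) => x; rewrite -[g (f x)](subrKC (g 0)).
  apply: le_trans (ler_normD _ _) _; rewrite lerD2l.
  by apply: le_trans (gK _ _) _; rewrite subr0 ler_wpM2l.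
exists (K * L) => [|x y]; first exact: mulr_ge0.
by apply: le_trans (gK _ _) _; rewrite -mulrA ler_wpM2l.
Qed.

Lemma blip_scale n c f : blip n f -> blip n (fun x => c * f x).
Proof. by apply: blip_mul; exact: blip_cst. Qed.

Lemma blip_leq n m f : (n <= m)%N -> blip n f -> blip m f.
Proof.
move=> nm [bf [L L0 fL]]; split=> //; exists L => // x y.
apply: le_trans (fL x y) _; rewrite ler_wpM2l //.
rewrite -(subnKC nm) big_split_ord /= lerDl; exact: sumr_ge0.
Qed.

Lemma blip_coord n (g : R -> R) : lipschitz_fun g ->
  (exists M : R, forall t, `|g t| <= M) -> blip n.+1 (fun x => g (x n)).
Proof.
move=> [L L0 gL] [M gM]; split; first by exists M.
exists L => // x y; apply: le_trans (gL _ _) _; rewrite ler_wpM2l //.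
by rewrite big_ord_recr /= lerDr; exact: sumr_ge0.
Qed.

Lemma blip_sum n (f : nat -> (nat -> R) -> R) m :
  (forall i, (i < m)%N -> blip n (f i)) -> blip n (fun x => \sum_(i < m) f i x).
Proof.
elim: m => [|m IH] fm.
  by under eq_fun do rewrite big_ord0; exact: blip_cst.
under eq_fun do rewrite big_ord_recr /=.
apply: blip_add; last exact: fm.
by apply: IH => i im; exact/fm/ltnW.
Qed.

Lemma blip_eq n f x y : blip n f -> (forall j, (j < n)%N -> x j = y j) -> f x = f y.
Proof.
move=> [_ [L _ fL]] xy; apply/eqP; rewrite -subr_eq0 -normr_le0.
apply: le_trans (fL x y) _; rewrite big1 ?mulr0 // => j _.
by rewrite xy ?subrr ?normr0.
Qed.

Lemma lipschitz_max0 : lipschitz_fun (fun t => Num.max 0 t).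
Proof.
exists 1 => // s t; rewrite mul1r.
by rewrite /Num.max; case: ltP => ?; case: ltP => ?; rewrite !ler_norml;
  have := ler_norm (s - t); have := ler_norm (- (s - t)); rewrite normrN; lra.
Qed.

(** A truncation that is Lipschitz, so that composition with it stays inside [H]. *)
Definition clamp (c t : R) : R := Num.max (- c) (Num.min c t).

Lemma clamp_bound c t : 0 <= c -> `|clamp c t| <= c.
Proof.
move=> c0; rewrite /clamp /Num.max /Num.min ler_norml.
by case: (ltP c t) => ?; case: ltP => ?; lra.
Qed.

Lemma clamp_norm_le c t : 0 <= c -> `|clamp c t| <= `|t|.
Proof.
move=> c0; have := ler_norm t; have := ler_norm (- t); rewrite normrN.
rewrite /clamp /Num.max /Num.min ler_norml.
by case: (ltP c t) => ?; case: ltP => ?; lra.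
Qed.

Lemma clamp_id c t : `|t| <= c -> clamp c t = t.
Proof.
rewrite /clamp /Num.max /Num.min ler_norml.
by case: (ltP c t) => ?; case: ltP => ?; lra.
Qed.

Lemma clamp_lipschitz c : 0 <= c -> lipschitz_fun (clamp c).
Proof.
move=> c0; exists 1 => // s t; rewrite mul1r /clamp /Num.max /Num.min.
have := ler_norm (s - t); have := ler_norm (- (s - t)); rewrite normrN !ler_norml.
by case: (ltP c s) => ?; case: (ltP c t) => ?; case: ltP => ?; case: ltP => ?; lra.
Qed.

(** The overshoot vanishes if [|t| <= c] and is at most [|t| <= t^2 / c] otherwise; thus second
    moments pay for truncation in mean. *)
Lemma clamp_dist c t : 0 < c -> `|t - clamp c t| <= t ^+ 2 / c.
Proof.
move=> c0; rewrite ler_pdivlMr //.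
have [tc|ct] := leP `|t| c.
  by rewrite clamp_id // subrr normr0 mul0r sqr_ge0.
have : `|t - clamp c t| <= `|t|.
  move: ct; rewrite /clamp /Num.max /Num.min.
  by have [t0|t0] := leP 0 t; [rewrite (ger0_norm t0)|rewrite (ltr0_norm t0)] => ct;
    rewrite ler_norml; case: (ltP c t) => ?; case: ltP => ?; lra.
rewrite -[t ^+ 2]real_normK ?num_real // expr2 => h.
by apply: ler_pM => //; exact/ltW.
Qed.

(** A frozen past [x] followed by the new value [y] at index [n]; the copies of [y] beyond [n] are
    invisible to functionals of [n.+1] terms. *)
Definition splice (n : nat) (x : nat -> R) (y : R) (j : nat) : R :=
  if (j < n)%N then x j else y.

Lemma splice_last n x (y : R) : splice n x y n = y.
Proof. by rewrite /splice ltnn. Qed.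

Lemma blip_splice n f x (y : R) : blip n f -> f (splice n x y) = f x.
Proof. by move=> bf; apply: (blip_eq n) => // j jn; rewrite /splice jn. Qed.

End BoundedLipschitz.

Section Independence.
Context {R : realType} {Omega : Type}.
Context {H : set (Omega -> R)} {E : (Omega -> R) -> \bar R}.
Hypothesis hE : sublinear_expectation_space H E.
Context {X : nat -> Omega -> R}.
Hypothesis HX : forall j, H (X j).

Local Notation e X := (fine (E X)).

Let sample (w : Omega) : nat -> R := fun j => X j w.

(** Bridge between the row vectors of [indep_of] and whole sequences. *)
Let unrow n (v : 'rV[R]_n) (y : R) (j : nat) : R :=
  if insub j is Some i then v 0 i else y.

Let unrow_row n w y j : (j < n)%N ->
  unrow n (\row_(i < n) X i w) y j = X j w.
Proof. by move=> jn; rewrite /unrow insubT mxE. Qed.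

Let unrow_dist n (v v' : 'rV[R]_n) y y' j :
  `|unrow n v y j - unrow n v' y' j| <= `|v - v'| + `|y - y'|.
Proof.
rewrite /unrow; case: insubP => [i _ _|_]; last by rewrite lerDr.
apply: (@le_trans _ _ `|v - v'|); last by rewrite lerDl.
have -> : v 0 i - v' 0 i = (v - v') 0 i by rewrite !mxE.
rewrite -[leRHS]/(mx_norm (v - v')) mx_normrE.
exact: (le_bigmax _ (fun ij => `|(v - v') ij.1 ij.2|) (0, i)).
Qed.

Let unrow_lip n m f : blip m f -> exists L, forall (v v' : 'rV[R]_n) y y',
  `|f (unrow n v y) - f (unrow n v' y')| <= L * (`|v - v'| + `|y - y'|).
Proof.
move=> [_ [L L0 fL]]; exists (L * m%:R) => v v' y y'.
apply: le_trans (fL _ _) _; rewrite -mulrA ler_wpM2l //.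
have : \sum_(j < m) `|unrow n v y j - unrow n v' y' j| <=
    \sum_(j < m) (`|v - v'| + `|y - y'|).
  by apply: ler_sum => j _; exact: unrow_dist.
by rewrite sumr_const card_ord mulr_natl.
Qed.

Lemma blip_rv n f : blip n f -> H (fun w => f (sample w)).
Proof.
move=> bf; case: (hE) => -[_ _ _ h] _.
have -> : (fun w => f (sample w)) = (fun w => f (unrow n (\row_(i < n) X i w) 0)).
  by apply/funext => w; apply: (blip_eq n) => // j jn; rewrite unrow_row.
apply: (h n (fun i => X i) (fun v => f (unrow n v 0))) => //.
have [L fL] := unrow_lip n n f bf; exists (L / 3), 0 => v v'.
by apply: (le_trans (fL v v' 0 0)); rewrite !expr0 subrr normr0; lra.
Qed.

Lemma blip_integrable n f : blip n f -> integrable_rv (H := H) (E := E) (fun w => f (sample w)).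
Proof.
move=> bf; have [[M fM] _] := bf.
exact: (integrable_bounded hE _ M (blip_rv n f bf)).
Qed.

Lemma splice_integrable n f x : blip n.+1 f ->
  integrable_rv (H := H) (E := E) (fun w => f (splice n x (X n w))).
Proof.
move=> [[M fM] [L L0 fL]]; apply: (integrable_bounded hE _ M) => //.
apply: (rv_lipschitz hE (fun y => f (splice n x y)) _ L) => // y y'.
apply: le_trans (fL _ _) _; rewrite ler_wpM2l // big_ord_recr /= big1 => [|j _].
  by rewrite add0r !splice_last.
by rewrite /splice ltn_ord subrr normr0.
Qed.

(** Integrating out the last variable keeps the bound and the Lipschitz constant, since [e] does not
    increase uniform distances. *)
Lemma splice_fine_E_blip n f : blip n.+1 f ->
  blip n (fun x => e (fun w => f (splice n x (X n w)))).
Proof.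
move=> bf; have [[M fM] [L L0 fL]] := bf; split.
  exists M => x; apply: (fine_E_norm_le hE) => //.
  by have [] := splice_integrable n f x bf.
exists L => // x y.
have key u v : e (fun w => f (splice n u (X n w))) <=
    e (fun w => f (splice n v (X n w))) + L * \sum_(j < n) `|u j - v j|.
  rewrite -[L * _](fine_E_cst hE); apply: (fine_E_le_dist hE).
  - exact: splice_integrable.
  - exact: splice_integrable.
  - exact: integrable_cst.
  move=> w; apply: le_trans (fL _ _) _; rewrite ler_wpM2l // big_ord_recr /=.
  rewrite !splice_last subrr normr0 addr0 le_eqVlt; apply/orP; left; apply/eqP.
  by apply: eq_bigr => j _; rewrite /splice ltn_ord.
rewrite ler_norml; apply/andP; split; last by rewrite lerBlDl; exact: key.
rewrite lerBrDr addrC lerBlDr.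
by under eq_bigr do rewrite distrC; exact: key.
Qed.

Hypothesis hind : forall n, (1 <= n)%N ->
  indep_of E (fun w => \row_(j < n) X j w) (X n).

(* [hind] says nothing about [n = 0], where the past is empty. *)
Lemma fine_E_indep n f : blip n.+1 f ->
  e (fun w => f (sample w)) =
  e (fun w => e (fun w' => f (splice n (sample w) (X n w')))).
Proof.
move=> bf; case: n bf => [|n] bf.
  have -> : (fun w => e (fun w' => f (splice 0 (sample w) (X 0%N w')))) =
      (fun _ => e (fun w' => f (sample w'))).
    apply/funext => w; congr (e _); apply/funext => w'.
    by apply: (blip_eq 1) => // -[].
  by rewrite (fine_E_cst hE).
have /(_ (fun v y => f (unrow n.+1 v y))) := hind n.+1 isT.
have -> : (fun w => f (unrow n.+1 (\row_(j < n.+1) X j w) (X n.+1 w))) =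
    (fun w => f (sample w)).
  apply/funext => w; apply: (blip_eq n.+2) => // j; rewrite ltnS leq_eqVlt.
  case/predU1P => [->|jn]; last exact: unrow_row.
  by rewrite /unrow insubF // ltnn.
have -> : (fun w => e (fun w' => f (unrow n.+1 (\row_(j < n.+1) X j w) (X n.+1 w')))) =
    (fun w => e (fun w' => f (splice n.+1 (sample w) (X n.+1 w')))).
  apply/funext => w; congr (e _); apply/funext => w'.
  apply: (blip_eq n.+2) => // j; rewrite ltnS leq_eqVlt.
  case/predU1P => [->|jn]; first by rewrite /unrow splice_last insubF // ltnn.
  by rewrite unrow_row // /splice jn.
move=> -> //; split; first by have [[M fM] _] := bf; exists M.
exact: unrow_lip bf.
Qed.

(** The supermartingale form of independence: a one-step bound valid for every frozen past
    integrates over the past. *)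
Lemma fine_E_indep_le n f g : blip n.+1 f -> blip n g ->
  (forall x, e (fun w => f (splice n x (X n w))) <= g x) ->
  e (fun w => f (sample w)) <= e (fun w => g (sample w)).
Proof.
move=> bf bg fg; rewrite (fine_E_indep n f bf); apply: (fine_E_le hE) => //.
- exact: (blip_integrable n (fun x => e (fun w => f (splice n x (X n w)))))
    (splice_fine_E_blip n f bf).
- exact: blip_integrable bg.
Qed.

End Independence.

(** * Sums and reflected walks *)

Section SumOfIndependent.
Context {R : realType} {Omega : Type}.
Context {H : set (Omega -> R)} {E : (Omega -> R) -> \bar R}.
Hypothesis hE : sublinear_expectation_space H E.
Context {X : nat -> Omega -> R}.
Hypothesis HX : forall j, H (X j).
Hypothesis hind : forall n, (1 <= n)%N ->
  indep_of E (fun w => \row_(j < n) X j w) (X n).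

Local Notation e X := (fine (E X)).

Lemma bounded_lipschitz_integrable (g : R -> R) j : lipschitz_fun g ->
  (exists M : R, forall t, `|g t| <= M) ->
  integrable_rv (H := H) (E := E) (fun w => g (X j w)).
Proof.
move=> lg bg.
exact: (blip_integrable hE HX j.+1 (fun x => g (x j)) (blip_coord j g lg bg)).
Qed.

(** Given the past, the earlier summands are a constant, and [e] commutes exactly with adding
    constants. This is used once for the inner and once for the outer expectation. *)
Lemma fine_E_sum_blip (g : nat -> R -> R) n :
  (forall j, lipschitz_fun (g j)) -> (forall j, exists M : R, forall t, `|g j t| <= M) ->
  e (fun w => \sum_(j < n) g j (X j w)) = \sum_(j < n) e (fun w => g j (X j w)).
Proof.
move=> lg bg; elim: n => [|n IH].
  by rewrite big_ord0; under eq_fun do rewrite big_ord0; rewrite (fine_E_cst hE).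
have bS m k : (m <= k)%N -> blip k (fun x : nat -> R => \sum_(j < m) g j (x j)).
  move=> mk; apply: (blip_sum k (fun j x => g j (x j))) => i im.
  by apply: (blip_leq i.+1); [exact: leq_trans mk|exact: blip_coord].
rewrite big_ord_recr /= -IH.
rewrite (fine_E_indep hE hind n _ (bS n.+1 n.+1 (leqnn _))).
rewrite -(fine_E_addc hE); last exact: (blip_integrable hE HX n _ (bS n n (leqnn _))).
congr (e _); apply/funext => w.
rewrite addrC -(fine_E_addc hE); last exact: bounded_lipschitz_integrable.
congr (e _); apply/funext => w'.
rewrite big_ord_recr /= splice_last addrC; congr (_ + _).
by apply: eq_bigr => j _; rewrite /splice ltn_ord.
Qed.

(** The half of additivity that sub-additivity does not give. Clamped summands are additive by
    independence, and clamping at level [c] costs at most [Q / c] on each side. *)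
Lemma sum_fine_E_le n (s : R) : `|s| <= 1 ->
  (forall j, (j < n)%N -> (E (fun w => (X j w ^+ 2)%R) < +oo)%E) ->
  \sum_(j < n) e (fun w => s * X j w) <= e (fun w => \sum_(j < n) s * X j w).
Proof.
move=> s1 fX2.
have iX j : (j < n)%N -> integrable_rv (H := H) (E := E) (X j).
  by move=> jn; have [] := integrable_of_sqr hE _ (HX j) (fX2 j jn).
have iX2 j : (j < n)%N -> integrable_rv (H := H) (E := E) (fun w => X j w ^+ 2).
  by move=> jn; have [] := integrable_of_sqr hE _ (HX j) (fX2 j jn).
pose Q := \sum_(j < n) e (fun w => X j w ^+ 2).
have Q0 : 0 <= Q.
  apply: sumr_ge0 => j _; rewrite -(fine_E_cst hE 0); apply: (fine_E_le hE).
  - exact: integrable_cst.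
  - exact: iX2.
  - by move=> w; exact: sqr_ge0.
apply/ler_addgt0Pr => eps eps0.
(* Chosen so that the two errors [Q / c] add up to at most [eps]; the summand 1 keeps [c] positive
   when [Q = 0]. *)
pose c := (2 * Q + 1) / eps.
have c0 : 0 < c by apply: divr_gt0 => //; lra.
have ls (j : nat) : lipschitz_fun (fun t : R => s * clamp c t).
  have [L L0 hL] := clamp_lipschitz c (ltW c0).
  exists L => // t u; rewrite -mulrBr normrM.
  by apply: le_trans (hL t u); rewrite ler_piMl.
have bs (j : nat) : exists M : R, forall t, `|s * clamp c t| <= M.
  exists c => t; rewrite normrM; apply: le_trans (clamp_bound c t (ltW c0)).
  by rewrite ler_piMl.
have dist j w : `|s * X j w - s * clamp c (X j w)| <= c^-1 * X j w ^+ 2.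
  rewrite -mulrBr normrM [leRHS]mulrC; apply: le_trans (clamp_dist c _ c0).
  by rewrite ler_piMl.
have iC j := bounded_lipschitz_integrable (fun t => s * clamp c t) j (ls j) (bs j).
have le1 : \sum_(j < n) e (fun w => s * X j w) <=
    \sum_(j < n) e (fun w => s * clamp c (X j w)) + c^-1 * Q.
  rewrite /Q mulr_sumr -big_split /=; apply: ler_sum => j _.
  rewrite -(fine_E_scale hE); first last.
  - exact: iX2.
  - by rewrite invr_ge0 ltW.
  apply: (fine_E_le_dist hE) => //.
  - by apply: (integrable_scale hE); exact: iX.
  - by apply: (integrable_scale hE); exact: iX2.
have le2 : e (fun w => \sum_(j < n) s * clamp c (X j w)) <=
    e (fun w => \sum_(j < n) s * X j w) + c^-1 * Q.
  have iD j : (j < n)%N ->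
      integrable_rv (H := H) (E := E) (fun w => c^-1 * X j w ^+ 2).
    by move=> jn; apply: (integrable_scale hE); exact: iX2.
  apply: (@le_trans _ _ (e (fun w => \sum_(j < n) s * X j w) +
                         e (fun w => \sum_(j < n) c^-1 * X j w ^+ 2))).
    apply: (fine_E_le_dist hE) => [|||w].
    - exact: (integrable_sum hE n (fun j w => s * clamp c (X j w))).
    - apply: (integrable_sum hE n (fun j w => s * X j w)) => j jn.
      by apply: (integrable_scale hE); exact: iX.
    - exact: (integrable_sum hE n (fun j w => c^-1 * X j w ^+ 2)).
    - rewrite -sumrB; apply: le_trans (ler_norm_sum _ _ _) _.
      by apply: ler_sum => j _; rewrite distrC.
  rewrite lerD2l; apply: le_trans (fine_E_sum hE n _ iD) _.
  rewrite /Q mulr_sumr; apply: ler_sum => j _.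
  rewrite (fine_E_scale hE) // ?invr_ge0 1?ltW //; exact: iX2.
have cQ : 2 * (c^-1 * Q) <= eps.
  rewrite /c invf_div mulrA mulrA -mulrAC ler_pdivrMr; first by nra.
  lra.
have := fine_E_sum_blip (fun _ t => s * clamp c t) n ls bs; lra.
Qed.

End SumOfIndependent.

Section ReflectedWalk.
Context {R : realType}.
Implicit Types (u : nat -> R) (m k : nat) (q : R).

(** Lindley's recursion: after [k] steps the value is the largest of 0 and the sums of [u] over
    final stretches of [[m, m + k)]. *)
Fixpoint refl u m k : R :=
  if k is k'.+1 then Num.max 0 (refl u m k' + u (m + k')%N) else 0.

(** Equal to 1 for [q t <= 1], to 0 for [q t >= 2], and linear in between. *)
Definition cutoff q (t : R) : R := Num.max 0 (clamp 1 (2 - q * t)).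

(** Lipschitz version of the indicator that the walk has stayed low so far; it vanishes for good
    once the walk reaches [2 / q]. *)
Fixpoint surv q u m k : R :=
  if k is k'.+1 then surv q u m k' * cutoff q (refl u m k) else 1.

(* [1 - surv] dominates the indicator of [2 / q <= max_(j <= k) refl u m j], and
   [(q t)^2 >= 1] wherever [cutoff q t < 1]; this makes [lyap] a supermartingale
   up to the variances of the increments. *)
Definition lyap q u m k : R :=
  (1 - surv q u m k) + surv q u m k * (q * refl u m k) ^+ 2.

Lemma refl_ge0 u m k : 0 <= refl u m k.
Proof. by case: k => [|k] //=; rewrite le_max lexx. Qed.

Lemma refl_le u u' m k : (forall j, (m <= j < m + k)%N -> u j <= u' j) ->
  refl u m k <= refl u' m k.
Proof.
elim: k => [|k IH] //= h; rewrite ge_max !le_max lexx /=; apply/orP; right.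
apply: lerD; last by apply: h; rewrite leq_addr addnS ltnS leqnn.
by apply: IH => j /andP[mj jk]; apply: h; rewrite mj addnS ltnS ltnW.
Qed.

(** Reflection is monotone and 1-Lipschitz, so it never amplifies a perturbation. The perturbation
    will be the shift of the means caused by clamping. *)
Lemma refl_addr_le u r m k : (forall j, 0 <= r j) ->
  refl (fun j => u j + r j) m k <= refl u m k + \sum_(j < k) r (m + j)%N.
Proof.
move=> r0; elim: k => [|k IH] /=; first by rewrite big_ord0 addr0.
rewrite big_ord_recr /= ge_max; apply/andP; split.
  by rewrite addr_ge0 ?addr_ge0 ?sumr_ge0 // le_max lexx.
apply: (@le_trans _ _ (refl u m k + u (m + k)%N + (\sum_(j < k) r (m + j)%N + r (m + k)%N))).
  by have := IH; lra.
by rewrite lerD2r le_max lexx orbT.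
Qed.

(** Two reflected walks with the same steps never drift apart, and the one restarted at 0 begins at
    distance [refl u m k]. This chains the blocks. *)
Lemma refl_restart u m k l : refl u m (k + l) <= refl u m k + refl u (m + k) l.
Proof.
elim: l => [|l IH]; first by rewrite addn0 addr0.
rewrite addnS /= ge_max addr_ge0 ?refl_ge0 //=; last by rewrite le_max lexx.
rewrite addnA; apply: (@le_trans _ _ (refl u m k + (refl u (m + k) l + u (m + k + l)%N))).
  by have := IH; lra.
by rewrite lerD2l le_max lexx orbT.
Qed.

(* One-sided substitute for Kronecker's lemma. *)
Lemma weighted_sum_le_refl (b u : nat -> R) m k :
  (forall j, 0 <= b j) -> (forall i j, (i <= j)%N -> b i <= b j) ->
  \sum_(j < k.+1) b (m + j)%N * u (m + j)%N <= b (m + k)%N * refl u m k.+1.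
Proof.
move=> b0 bmono.
have step (x y : R) : 0 <= x -> x * y <= x * Num.max 0 y.
  by move=> x0; rewrite ler_wpM2l // le_max lexx orbT.
elim: k => [|k IH]; first by rewrite big_ord1 /= add0r step.
rewrite big_ord_recr [refl _ _ _]/=.
apply: le_trans (step _ _ (b0 _)); rewrite mulrDr lerD2r.
apply: le_trans IH _; rewrite ler_wpM2r ?refl_ge0 //.
by apply: bmono; rewrite leq_add2l.
Qed.

Lemma cutoff_ge0 q t : 0 <= cutoff q t.
Proof. by rewrite /cutoff le_max lexx. Qed.

Lemma cutoff_le1 q t : cutoff q t <= 1.
Proof.
rewrite /cutoff ge_max ler01 /=.
by apply: le_trans (ler_norm _) (clamp_bound _ _ _).
Qed.

Lemma cutoff_gt0 q t : 0 < cutoff q t -> q * t < 2.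
Proof.
rewrite /cutoff lt_max ltxx /= /clamp /Num.max /Num.min.
by case: (ltP 1 (2 - q * t)) => ?; case: (ltP (- 1) _) => ? ?; lra.
Qed.

Lemma cutoff_quadratic q t : 1 - cutoff q t <= (1 - cutoff q t) * (q * t) ^+ 2.
Proof.
have [h|h] := leP 1 (q * t).
  rewrite ler_peMr ?subr_ge0 ?cutoff_le1 //; nra.
suff -> : cutoff q t = 1 by rewrite subrr mul0r.
rewrite /cutoff /clamp /Num.max /Num.min.
by case: (ltP 1 (2 - q * t)) => ?; case: (ltP (-1) _) => ?; case: ltP => ?; lra.
Qed.

Lemma surv_ge0 q u m k : 0 <= surv q u m k.
Proof. by elim: k => [|k IH] //=; rewrite mulr_ge0 // cutoff_ge0. Qed.

Lemma surv_le1 q u m k : surv q u m k <= 1.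
Proof.
elim: k => [|k IH] //=; apply: mulr_ile1; rewrite ?surv_ge0 ?cutoff_ge0 //.
exact: cutoff_le1.
Qed.

Lemma lyap_ge0 q u m k : 0 <= lyap q u m k.
Proof.
apply: addr_ge0; first by rewrite subr_ge0 surv_le1.
by apply: mulr_ge0; [exact: surv_ge0|exact: sqr_ge0].
Qed.

(** If [surv] were 0 then [lyap] would be 1. So the product is positive, hence each of its cutoff
    factors is. *)
Lemma lyap_lt1 q u m k j : lyap q u m k < 1 -> (j <= k)%N -> q * refl u m j < 2.
Proof.
move=> h jk; have : 0 < surv q u m k.
  rewrite lt_neqAle surv_ge0 andbT; apply/eqP => s0.
  by move: h; rewrite /lyap -s0; lra.
elim: k jk {h} => [|k IH]; first by rewrite leqn0 => /eqP-> _; rewrite mulr0.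
rewrite leq_eqVlt => /predU1P[->|jk]; rewrite [surv _ _ _ _]/= => h.
  apply: cutoff_gt0; rewrite lt_neqAle cutoff_ge0 andbT; apply/eqP => c0.
  by move: h; rewrite -[refl u m k.+1]/(Num.max _ _) in c0 *; rewrite -c0 mulr0 ltxx.
apply: IH => //; rewrite lt_neqAle surv_ge0 andbT; apply/eqP => s0.
by move: h; rewrite -s0 mul0r ltxx.
Qed.

(** The mass [h (1 - c)] killed at this step is paid for by the quadratic term through
    [cutoff_quadratic]; then [max(0, x)^2 <= x^2] removes the reflection. *)
Lemma lyap_step q u m k :
  lyap q u m k.+1 <= 1 - surv q u m k +
    surv q u m k * (q * (refl u m k + u (m + k)%N)) ^+ 2.
Proof.
rewrite /lyap [surv _ _ _ k.+1]/=; set h := surv _ _ _ _.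
have h0 : 0 <= h by exact: surv_ge0.
have := ler_wpM2l h0 (cutoff_quadratic q (refl u m k.+1)).
set c := cutoff _ _; set M := refl u m k.+1; set N := refl u m k + _.
have MN : (q * M) ^+ 2 <= (q * N) ^+ 2.
  rewrite !exprMn ler_wpM2l ?sqr_ge0 // /M /= -/N /Num.max.
  by case: ltP => // _; rewrite expr0n /= sqr_ge0.
have := ler_wpM2l h0 MN; lra.
Qed.

End ReflectedWalk.

(** * The maximal inequality *)

Section MaximalInequality.
Context {R : realType} {Omega : Type}.
Context {H : set (Omega -> R)} {E : (Omega -> R) -> \bar R}.
Hypothesis hE : sublinear_expectation_space H E.
Context {X : nat -> Omega -> R}.
Hypothesis HX : forall j, H (X j).
Hypothesis hind : forall n, (1 <= n)%N ->
  indep_of E (fun w => \row_(j < n) X j w) (X n).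

Local Notation e X := (fine (E X)).

Context {g : nat -> R -> R} {v : nat -> R}.
Hypothesis lg : forall j, lipschitz_fun (g j).
Hypothesis bg : forall j, exists M : R, forall t, `|g j t| <= M.
Hypothesis g_mean : forall j, e (fun w => g j (X j w)) <= 0.
Hypothesis g_var : forall j, e (fun w => g j (X j w) ^+ 2) <= v j.

Let incr (x : nat -> R) (j : nat) : R := g j (x j).

Let refl_blip m k : blip (m + k) (fun x => refl (incr x) m k).
Proof.
elim: k => [|k IH]; first exact: blip_cst.
apply: (blip_comp _ (fun x => refl (incr x) m k + g (m + k)%N (x (m + k)%N))).
  exact: lipschitz_max0.
rewrite addnS; apply: blip_add; last exact: blip_coord.
exact: blip_leq IH.
Qed.

Let surv_blip q m k : blip (m + k) (fun x => surv q (incr x) m k).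
Proof.
elim: k => [|k IH]; first exact: blip_cst.
apply: (blip_mul _ (fun x => surv q (incr x) m k)
                   (fun x => cutoff q (refl (incr x) m k.+1))).
  by apply: blip_leq IH; rewrite leq_add2l.
apply: (blip_comp _ (fun x => clamp 1 (2 - q * refl (incr x) m k.+1))).
  exact: lipschitz_max0.
apply: (blip_comp _ (fun x => 2 - q * refl (incr x) m k.+1)).
  exact: clamp_lipschitz.
apply: blip_add; first exact: blip_cst.
under eq_fun do rewrite -mulNr; exact: blip_scale.
Qed.

Let lyap_blip q m k : blip (m + k) (fun x => lyap q (incr x) m k).
Proof.
apply: blip_add.
  apply: blip_add; first exact: blip_cst.
  by under eq_fun do rewrite -mulN1r; exact: blip_scale.
apply: blip_mul => //; apply: blip_mul; exact: blip_scale.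
Qed.

Lemma lyap_integrable q m k :
  integrable_rv (H := H) (E := E) (fun w => lyap q (fun j => g j (X j w)) m k).
Proof. exact: (blip_integrable hE HX _ _ (lyap_blip q m k)). Qed.

(** A Kolmogorov-type maximal inequality: [lyap] starts at 0, and each step raises its mean by at
    most [q^2] times the variance bound. *)
Lemma fine_E_lyap_le q m k : 0 <= q ->
  e (fun w => lyap q (fun j => g j (X j w)) m k) <= q ^+ 2 * \sum_(j < k) v (m + j)%N.
Proof.
move=> q0; elim: k => [|k IH].
  rewrite big_ord0 mulr0 /lyap /=.
  by under eq_fun do rewrite subrr mulr0 expr0n /= mulr0 addr0; rewrite (fine_E_cst hE).
pose c := q ^+ 2 * v (m + k)%N.
have bnd : blip (m + k) (fun x => lyap q (incr x) m k + c).
  by apply: blip_add => //; exact: blip_cst.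
rewrite big_ord_recr /= mulrDr; apply: (@le_trans _ _
    (e (fun w => lyap q (fun j => g j (X j w)) m k + c))); last first.
  rewrite (fine_E_addc hE) ?lerD2r //.
  exact: lyap_integrable.
have bl : blip (m + k).+1 (fun x => lyap q (incr x) m k.+1).
  by rewrite -addnS; exact: lyap_blip.
apply: (fine_E_indep_le hE HX hind (m + k) (fun x => lyap q (incr x) m k.+1)
  (fun x => lyap q (incr x) m k + c)) => // x.
set h := surv q (incr x) m k; set M := refl (incr x) m k.
have h0 : 0 <= h by exact: surv_ge0.
have h1 : h <= 1 by exact: surv_le1.
have M0 : 0 <= M by exact: refl_ge0.
pose xi w := g (m + k)%N (X (m + k)%N w).
have ixi : integrable_rv (H := H) (E := E) xi.
  exact: (bounded_lipschitz_integrable hE HX).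
have ixi2 : integrable_rv (H := H) (E := E) (fun w => xi w ^+ 2).
  by apply: (blip_integrable hE HX (m + k).+1 (fun x => incr x (m + k)%N * incr x (m + k)%N));
    apply: blip_mul; exact: blip_coord.
have il : integrable_rv (H := H) (E := E) (fun w => 2 * h * q ^+ 2 * M * xi w).
  exact: (integrable_scale hE).
have iq : integrable_rv (H := H) (E := E) (fun w => h * q ^+ 2 * xi w ^+ 2).
  exact: (integrable_scale hE).
(* With the past frozen, the one-step bound is a quadratic polynomial in [xi] whose constant term
   [d] is the current value of [lyap]. *)
pose d := 1 - h + h * (q * M) ^+ 2.
apply: (@le_trans _ _ (e (fun w => (2 * h * q ^+ 2 * M * xi w + h * q ^+ 2 * xi w ^+ 2) + d))).
  apply: (fine_E_le hE).
  - exact: (splice_integrable hE HX (m + k) (fun x => lyap q (incr x) m k.+1)).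
  - by apply: (integrable_add hE); [exact: (integrable_add hE)|exact: integrable_cst].
  move=> w; apply: le_trans (lyap_step _ _ _ _) _.
  rewrite (blip_splice _ (fun x => surv q (incr x) m k)) //.
  rewrite (blip_splice _ (fun x => refl (incr x) m k)) //.
  have -> : incr (splice (m + k) x (X (m + k)%N w)) (m + k)%N = xi w.
    by rewrite /incr splice_last.
  rewrite -/h -/M /d.
  by rewrite le_eqVlt; apply/orP; left; apply/eqP; ring.
rewrite (fine_E_addc hE); last exact: (integrable_add hE).
(* Here [M >= 0] is essential: positive homogeneity carries the sign of the upper mean only through
   a non-negative coefficient. *)
have le1 : e (fun w => 2 * h * q ^+ 2 * M * xi w) <= 0.
  have c0 : 0 <= 2 * h * q ^+ 2 * M by rewrite !mulr_ge0 ?sqr_ge0.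
  by rewrite (fine_E_scale hE) // mulr_ge0_le0 //; exact: g_mean.
have le2 : e (fun w => h * q ^+ 2 * xi w ^+ 2) <= c.
  rewrite (fine_E_scale hE) ?mulr_ge0 ?sqr_ge0 // /c -mulrA.
  apply: (@le_trans _ _ (q ^+ 2 * e (fun w => xi w ^+ 2))).
    rewrite ler_piMl // mulr_ge0 ?sqr_ge0 //.
    rewrite -(fine_E_cst hE 0); apply: (fine_E_le hE) => // [|w].
      exact: integrable_cst.
    exact: sqr_ge0.
  by rewrite ler_wpM2l ?sqr_ge0 //; exact: g_var.
have := fine_E_add hE _ _ il iq.
by rewrite /lyap -/h -/M -/d; lra.
Qed.

End MaximalInequality.

(** * Clamped, centred and rescaled increments *)

Section ClampedIncrement.
Context {R : realType} {Omega : Type}.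
Context {H : set (Omega -> R)} {E : (Omega -> R) -> \bar R}.
Hypothesis hE : sublinear_expectation_space H E.

Local Notation e X := (fine (E X)).

Context {X : Omega -> R} {b s : R}.
Hypothesis HX : H X.
Hypothesis fX2 : (E (fun w => (X w ^+ 2)%R) < +oo)%E.
Hypothesis b1 : 1 <= b.
Hypothesis s1 : `|s| <= 1.

Let b0 : 0 < b. Proof. exact: lt_le_trans b1. Qed.

(** Centred at the upper mean of the clamped variable, so that its own upper mean is exactly 0. The
    factor [s] will be 1 or -1, for the upper and the lower limit. *)
Definition std_clamp (t : R) : R :=
  b^-1 * (s * clamp b t - e (fun w => s * clamp b (X w))).

Lemma scaled_clamp_lipschitz : lipschitz_fun (fun t => s * clamp b t).
Proof.
have [L L0 hL] := clamp_lipschitz b (ltW b0).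
exists L => // t u; rewrite -mulrBr normrM.
by apply: le_trans (hL t u); rewrite ler_piMl.
Qed.

Lemma std_clamp_lipschitz : lipschitz_fun std_clamp.
Proof.
have [L L0 hL] := scaled_clamp_lipschitz.
exists L => // t u; rewrite /std_clamp -mulrBr opprB addrA subrK normrM.
apply: le_trans (hL t u); rewrite ler_piMl // ger0_norm ?invr_ge0 ?(ltW b0) //.
by rewrite invf_le1.
Qed.

Lemma std_clamp_bounded : exists M : R, forall t, `|std_clamp t| <= M.
Proof.
exists (b^-1 * (b + `|e (fun w => s * clamp b (X w))|)) => t.
rewrite normrM ger0_norm ?invr_ge0 ?(ltW b0) // ler_wpM2l ?invr_ge0 ?(ltW b0) //.
apply: le_trans (ler_normB _ _) _; rewrite lerD2r normrM.
by apply: le_trans (clamp_bound b t (ltW b0)); rewrite ler_piMl.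
Qed.

Let Y w := s * clamp b (X w).

Let YX w : `|Y w| <= `|X w|.
Proof.
rewrite normrM; apply: le_trans (clamp_norm_le b _ (ltW b0)).
by rewrite ler_piMl.
Qed.

Let YX2 w : Y w ^+ 2 <= X w ^+ 2.
Proof.
rewrite -[Y w ^+ 2]real_normK ?num_real // -[X w ^+ 2]real_normK ?num_real //.
by rewrite ler_sqr ?nnegrE.
Qed.

Let HY : H Y.
Proof.
have [L _ hL] := scaled_clamp_lipschitz.
exact: (rv_lipschitz hE _ _ L HX hL).
Qed.

Let iX : integrable_rv (H := H) (E := E) X.
Proof. by have [] := integrable_of_sqr hE _ HX fX2. Qed.

Let iX2 : integrable_rv (H := H) (E := E) (fun w => X w ^+ 2).
Proof. by have [] := integrable_of_sqr hE _ HX fX2. Qed.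

Let iY : integrable_rv (H := H) (E := E) Y.
Proof. exact: (integrable_dom hE _ _ HY (integrable_abs hE _ iX)). Qed.

Let iY2 : integrable_rv (H := H) (E := E) (fun w => Y w ^+ 2).
Proof.
apply: (integrable_dom hE _ _ (rv_sqr hE _ HY) iX2) => w.
by rewrite ger0_norm ?sqr_ge0.
Qed.

Lemma std_clamp_mean : e (fun w => std_clamp (X w)) = 0.
Proof.
rewrite /std_clamp (fine_E_scale hE) ?invr_ge0 ?(ltW b0) //; last first.
  by apply: (integrable_add hE) => //; exact: integrable_cst.
by rewrite (fine_E_addc hE) // subrr mulr0.
Qed.

(** The factor 4 comes from [(Y - mu)^2 <= 2 Y^2 + 2 mu^2] together with
    [mu^2 <= e (Y^2) <= e (X^2)]. *)
Lemma std_clamp_var :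
  e (fun w => std_clamp (X w) ^+ 2) <= 4 * (e (fun w => X w ^+ 2) / b ^+ 2).
Proof.
set mu := e (fun w => s * clamp b (X w)).
have b20 : 0 <= b ^- 2 by rewrite invr_ge0 sqr_ge0.
have iB : integrable_rv (H := H) (E := E) (fun w => 2 * Y w ^+ 2 + 2 * mu ^+ 2).
  apply: (integrable_add hE); last exact: integrable_cst.
  exact: (integrable_scale hE).
have iS : integrable_rv (H := H) (E := E) (fun w => std_clamp (X w) ^+ 2).
  have iC : integrable_rv (H := H) (E := E) (fun w => b ^- 2 * (2 * Y w ^+ 2 + 2 * mu ^+ 2)).
    exact: (integrable_scale hE).
  have [L _ hL] := std_clamp_lipschitz.
  apply: (integrable_dom hE _ _ _ iC).
    exact: (rv_sqr hE _ (rv_lipschitz hE _ _ L HX hL)).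
  move=> w; rewrite ger0_norm ?sqr_ge0 // /std_clamp exprMn exprVn ler_wpM2l //.
  by rewrite -/(Y w) -/mu; have := sqr_ge0 (Y w + mu); lra.
apply: (@le_trans _ _ (e (fun w => b ^- 2 * (2 * Y w ^+ 2 + 2 * mu ^+ 2)))).
  apply: (fine_E_le hE) => // [|w]; first exact: (integrable_scale hE).
  rewrite /std_clamp exprMn exprVn ler_wpM2l //.
  by rewrite -/(Y w) -/mu; have := sqr_ge0 (Y w + mu); lra.
rewrite (fine_E_scale hE) // mulrA [leRHS]mulrC ler_wpM2l //.
rewrite (fine_E_addc hE); last exact: (integrable_scale hE).
rewrite (fine_E_scale hE) //.
have le1 : mu ^+ 2 <= e (fun w => Y w ^+ 2) by exact: (sqr_fine_E_le hE).
have le2 : e (fun w => Y w ^+ 2) <= e (fun w => X w ^+ 2) by exact: (fine_E_le hE).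
lra.
Qed.

(** Where the clamp does not act, only the centring constants differ, by at most [e (X^2) / b]; the
    prefactor supplies the second [b]. *)
Lemma std_clampE (t : R) : `|t| <= b ->
  b^-1 * (s * t - e (fun w => s * X w)) <=
  std_clamp t + e (fun w => X w ^+ 2) / b ^+ 2.
Proof.
move=> tb; rewrite /std_clamp clamp_id //.
have -> : e (fun w => X w ^+ 2) / b ^+ 2 = b^-1 * (b^-1 * e (fun w => X w ^+ 2)).
  by rewrite mulrA -expr2 exprVn mulrC.
rewrite -mulrDr ler_wpM2l ?invr_ge0 ?(ltW b0) // -(fine_E_scale hE) //; last first.
  by rewrite invr_ge0 ltW.
suff : e Y <= e (fun w => s * X w) + e (fun w => b^-1 * X w ^+ 2).
  by rewrite /Y; lra.
apply: (fine_E_le_dist hE) => // [||w].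
- exact: (integrable_scale hE).
- exact: (integrable_scale hE).
rewrite /Y -mulrBr normrM distrC [leRHS]mulrC.
by apply: le_trans (clamp_dist b _ b0); rewrite ler_piMl.
Qed.

End ClampedIncrement.
Arguments std_clamp {R Omega} E X b s t.

(** * Capacities *)

Lemma half_pow_le {R : realType} (eps : R) : 0 < eps ->
  exists K, forall k, (K <= k)%N -> (2^-1 : R) ^+ k <= eps.
Proof.
move=> eps0; exists (Num.bound eps^-1) => k Kk.
rewrite exprVn -[leRHS]invrK lef_pV2 ?posrE ?exprn_gt0 ?invr_gt0 //.
exact/ltW/upper_nthrootP.
Qed.

Section BorelCantelli.
Context {R : realType} {d : measure_display} {Omega : measurableType d}.
Context {H : set (Omega -> R)} {E : (Omega -> R) -> \bar R}.
Hypothesis hE : sublinear_expectation_space H E.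

Lemma Vhat_ge0 A : (0 <= Vhat H E A)%E.
Proof.
apply: le_ereal_inf_tmp => _ [xi [Hxi Axi] <-].
have -> : 0%E = E (fun _ => 0) by rewrite (E_cst hE).
apply: (E_le hE) => //; first exact: rv_cst hE _.
by move=> w; apply: le_trans (Axi w); rewrite indicE.
Qed.

Lemma Vhat_le A xi : H xi -> (forall w, \1_A w <= xi w) -> (Vhat H E A <= E xi)%E.
Proof. by move=> Hxi Axi; apply: ereal_inf_lbound; exists xi. Qed.

Lemma Vstar_ge0 A : (0 <= Vstar H E A)%E.
Proof.
apply: le_ereal_inf_tmp => _ [B _ <-].
by apply: nneseries_ge0 => n _ _; exact: Vhat_ge0.
Qed.

Lemma sum_half_pow_le K n :
  \sum_(0 <= i < n) (2^-1 : R) ^+ (K + i) <= 2 * 2^-1 ^+ K.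
Proof.
have -> : \sum_(0 <= i < n) (2^-1 : R) ^+ (K + i) =
    2 * 2^-1 ^+ K - 2 * 2^-1 ^+ (K + n).
  elim: n => [|n IH]; first by rewrite big_geq // addn0 subrr.
  by rewrite big_nat_recr //= IH addnS exprS; lra.
by rewrite gerBl mulr_ge0 // exprn_ge0 // invr_ge0.
Qed.

(** Every tail of [D] is itself an admissible covering in the definition of [Vstar], of total cost
    at most [2 * 2^-K]. *)
Lemma Vstar_limsup_eq0 A (D : nat -> set Omega) :
  (forall i, measurable (D i)) ->
  (forall i, Vhat H E (D i) <= ((2^-1 : R) ^+ i)%:E)%E ->
  (forall K, A `<=` \bigcup_i D (K + i)%N) -> Vstar H E A = 0%E.
Proof.
move=> mD VD AD; apply/le_anti/andP; split; last exact: Vstar_ge0.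
have bound K : (Vstar H E A <= (2 * (2^-1 : R) ^+ K)%:E)%E.
  apply: (@le_trans _ _ (\sum_(0 <= i <oo) Vhat H E (D (K + i)%N))%E).
    apply: ereal_inf_lbound; by exists (fun i => D (K + i)%N).
  apply: (@lime_le _ _ _ _ _ (fun n => \sum_(0 <= i < n) Vhat H E (D (K + i)%N))%E).
    by apply: is_cvg_nneseries => i _ _; exact: Vhat_ge0.
  apply: nearW => n.
  apply: (@le_trans _ _ (\sum_(0 <= i < n) ((2^-1 : R) ^+ (K + i))%:E)%E).
    by apply: lee_sum => i _; exact: VD.
  by rewrite sumEFin lee_fin; exact: sum_half_pow_le.
apply/lee_addgt0Pr => eps eps0; rewrite add0e.
have [K hK] : exists K, 2 * (2^-1 : R) ^+ K <= eps.
  have [K hK] := half_pow_le (eps / 2) ltac:(by rewrite divr_gt0).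
  by exists K; have := hK K (leqnn K); lra.
by apply: le_trans (bound K) _; rewrite lee_fin.
Qed.

End BorelCantelli.

(** * Upper limits and tails of convergent series of real numbers *)

Section LimSup.
Context {R : realType}.

Lemma limn_esup_le0 (u : nat -> R) :
  (forall eps : R, 0 < eps -> exists N, forall n, (N <= n)%N -> u n <= eps) ->
  (limn_esup (fun n => (u n)%:E) <= 0)%E.
Proof.
move=> hu; apply/lee_addgt0Pr => eps eps0; rewrite add0e.
have [N hN] := hu eps eps0.
rewrite limn_esup_lim (cvg_lim _ (@cvg_esups_inf _ _)) //.
apply: (@le_trans _ _ (esups (fun n => (u n)%:E) N)).
  by apply: ereal_inf_lbound; exists N.
by apply: ge_ereal_sup => _ [n /= Nn <-]; rewrite lee_fin; exact: hN.
Qed.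

(** Once a partial sum is within [eps] of the supremum, any later stretch has to fit into the
    remaining gap. *)
Lemma bounded_sum_tail (v : nat -> R) (T : R) : (forall j, 0 <= v j) ->
  (forall n, \sum_(j < n) v j <= T) ->
  forall eps : R, 0 < eps -> exists N, forall m k, (N <= m)%N ->
    \sum_(j < k) v (m + j)%N <= eps.
Proof.
move=> v0 vT eps eps0.
pose A := [set \sum_(j < n) v j | n in [set: nat]].
have hA : has_sup A.
  split; first by exists (\sum_(j < 0) v j), 0%N.
  by exists T => _ [n _ <-].
have [_ [N _ <-] hN] := sup_adherent eps0 hA.
exists N => m k Nm.
have : \sum_(j < m + k) v j <= sup A.
  by apply: ub_le_sup; [exact: hA.2|exists (m + k)%N].
have : \sum_(j < N) v j <= \sum_(j < m) v j.
  by rewrite -(subnKC Nm) big_split_ord /= lerDl; exact: sumr_ge0.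
rewrite big_split_ord /=; lra.
Qed.

End LimSup.

(** * Measurability of the walk functionals, since [Vstar] admits only measurable coverings *)

Section MeasurableWalk.
Context {R : realType} {d : measure_display} {Omega : measurableType d}.
Context {u : Omega -> nat -> R}.
Hypothesis mu : forall j, measurable_fun setT (fun w => u w j).

Lemma measurable_refl m k : measurable_fun setT (fun w => refl (u w) m k).
Proof.
elim: k => [|k IH]; first exact: measurable_cst.
apply: (@measurable_maxr _ _ _ _ (fun _ => 0) (fun w => refl (u w) m k + u w (m + k)%N)).
  exact: measurable_cst.
exact: measurable_funD.
Qed.

Lemma measurable_clamp c (f : Omega -> R) : measurable_fun setT f ->
  measurable_fun setT (fun w => clamp c (f w)).
Proof.
move=> mf.
apply: (@measurable_maxr _ _ _ _ (fun _ => - c) (fun w => Num.min c (f w))).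
  exact: measurable_cst.
by apply: (@measurable_minr _ _ _ _ (fun _ => c) f) => //; exact: measurable_cst.
Qed.

Lemma measurable_surv q m k : measurable_fun setT (fun w => surv q (u w) m k).
Proof.
elim: k => [|k IH]; first exact: measurable_cst.
apply: (@measurable_funM _ _ _ _ (fun w => surv q (u w) m k)
          (fun w => cutoff q (refl (u w) m k.+1))) => //.
apply: (@measurable_maxr _ _ _ _ (fun _ => 0)
          (fun w => clamp 1 (2 - q * refl (u w) m k.+1))).
  exact: measurable_cst.
apply: measurable_clamp; apply: measurable_funB; first exact: measurable_cst.
by apply: measurable_funM; [exact: measurable_cst|exact: measurable_refl].
Qed.

Lemma measurable_lyap q m k : measurable_fun setT (fun w => lyap q (u w) m k).
Proof.
apply: measurable_funD.
  by apply: measurable_funB; [exact: measurable_cst|exact: measurable_surv].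
apply: measurable_funM; first exact: measurable_surv.
apply: measurable_funX; apply: measurable_funM; first exact: measurable_cst.
exact: measurable_refl.
Qed.

End MeasurableWalk.

(** * Blocks *)

Section BlockArgument.
Context {R : realType} {d : measure_display} {Omega : measurableType d}.
Context {H : set (Omega -> R)} {E : (Omega -> R) -> \bar R}.
Hypothesis hE : sublinear_expectation_space H E.
Context {X : nat -> Omega -> R} {b : nat -> R}.
Hypothesis HX : forall j, H (X j).
Hypothesis mX : forall j, measurable_fun setT (X j).
Hypothesis hind : forall n, (1 <= n)%N ->
  indep_of E (fun w => \row_(j < n) X j w) (X n).
Hypothesis fX2 : forall j, (E (fun w => (X j w ^+ 2)%R) < +oo)%E.
Hypothesis b1 : forall j, 1 <= b j.
Hypothesis bmono : forall i j, (i <= j)%N -> b i <= b j.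
Hypothesis bcvg : forall A : R, exists N, forall n, (N <= n)%N -> A <= b n.

Local Notation e X := (fine (E X)).

Let v j := e (fun w => X j w ^+ 2) / b j ^+ 2.

Hypothesis v_tail : forall eps : R, 0 < eps -> exists N, forall m k, (N <= m)%N ->
  \sum_(j < k) v (m + j)%N <= eps.

Let b0 j : 0 < b j. Proof. exact: lt_le_trans (b1 j). Qed.

Let iX2 j : integrable_rv (H := H) (E := E) (fun w => X j w ^+ 2).
Proof. by have [] := integrable_of_sqr hE _ (HX j) (fX2 j). Qed.

Let v0 j : 0 <= v j.
Proof.
rewrite divr_ge0 ?sqr_ge0 // -(fine_E_cst hE 0); apply: (fine_E_le hE) => // [|w].
  exact: integrable_cst.
exact: sqr_ge0.
Qed.

Let incr (s : R) (w : Omega) (j : nat) : R := std_clamp E (X j) (b j) s (X j w).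

(** The true increments, as opposed to the clamped [incr] to which the maximal inequality
    applies. *)
Let eta (s : R) (w : Omega) (j : nat) : R :=
  (b j)^-1 * (s * X j w - e (fun w => s * X j w)).

(** One random variable whose value below 1 controls both signed walks and, through the sum of
    squares, prevents clamping throughout the block. *)
Definition bad (q : R) (m k : nat) (w : Omega) : R :=
  lyap q (incr 1 w) m k + lyap q (incr (- 1) w) m k +
  \sum_(j < k) (b (m + j)%N ^+ 2)^-1 * X (m + j)%N w ^+ 2.

Let lyap_ok (s q : R) m k : `|s| <= 1 -> 0 <= q ->
  integrable_rv (H := H) (E := E) (fun w => lyap q (incr s w) m k) /\
  e (fun w => lyap q (incr s w) m k) <= 4 * q ^+ 2 * \sum_(j < k) v (m + j)%N.
Proof.
move=> s1 q0; have ls j : lipschitz_fun (std_clamp E (X j) (b j) s).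
  exact: std_clamp_lipschitz.
have bs j : exists M : R, forall t, `|std_clamp E (X j) (b j) s t| <= M.
  exact: std_clamp_bounded.
split; first exact: (lyap_integrable hE HX (g := fun j => std_clamp E (X j) (b j) s) ls bs).
rewrite [4 * _]mulrC -mulrA mulr_sumr.
have := fine_E_lyap_le hE HX hind (g := fun j => std_clamp E (X j) (b j) s)
  (v := fun j => 4 * v j) ls bs _ _ q m k q0.
apply => j.
- by rewrite (std_clamp_mean hE).
- exact: (std_clamp_var hE (HX j) (fX2 j) (b1 j) s1).
Qed.

Let norm1 : `|1 : R| <= 1. Proof. by rewrite normr1. Qed.
Let normN1 : `|- 1 : R| <= 1. Proof. by rewrite normrN1. Qed.

Let sq_ok m k :
  integrable_rv (H := H) (E := E)
    (fun w => \sum_(j < k) (b (m + j)%N ^+ 2)^-1 * X (m + j)%N w ^+ 2) /\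
  e (fun w => \sum_(j < k) (b (m + j)%N ^+ 2)^-1 * X (m + j)%N w ^+ 2) <=
    \sum_(j < k) v (m + j)%N.
Proof.
have iS j : integrable_rv (H := H) (E := E)
    (fun w => (b (m + j)%N ^+ 2)^-1 * X (m + j)%N w ^+ 2).
  exact: (integrable_scale hE).
split.
  exact: (integrable_sum hE k (fun j w => (b (m + j)%N ^+ 2)^-1 * X (m + j)%N w ^+ 2)).
apply: le_trans (fine_E_sum hE k _ (fun j _ => iS j)) _.
apply: ler_sum => j _; rewrite (fine_E_scale hE) //.
  by rewrite /v mulrC.
by rewrite invr_ge0 sqr_ge0.
Qed.

Let bad_ge0 q m k w : 0 <= bad q m k w.
Proof.
apply: addr_ge0; first by apply: addr_ge0; exact: lyap_ge0.
by apply: sumr_ge0 => j _; rewrite mulr_ge0 ?invr_ge0 ?sqr_ge0.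
Qed.

(** Markov's inequality: [bad] is non-negative, so it dominates the indicator. Each sign contributes
    [4 q^2] and the squares contribute 1. *)
Lemma Vhat_bad_le q m k : 0 <= q ->
  (Vhat H E [set w | (1 <= bad q m k w)%R] <=
   ((8 * q ^+ 2 + 1) * \sum_(j < k) v (m + j)%N)%:E)%E.
Proof.
move=> q0.
have [i1 le1] := lyap_ok 1 q m k norm1 q0.
have [i2 le2] := lyap_ok (- 1) q m k normN1 q0.
have [i3 le3] := sq_ok m k.
have i12 : integrable_rv (H := H) (E := E)
    (fun w => lyap q (incr 1 w) m k + lyap q (incr (- 1) w) m k).
  exact: (integrable_add hE).
have i123 : integrable_rv (H := H) (E := E) (bad q m k) by exact: (integrable_add hE).
have [HB _] := i123.
apply: (@le_trans _ _ (E (bad q m k))).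
  apply: (Vhat_le _ _ HB) => w; rewrite indicE.
  by have [|_] := boolP (w \in _); [rewrite inE|exact: bad_ge0].
rewrite (integrable_fin hE _ i123) lee_fin.
have := fine_E_add hE _ _ i12 i3; have := fine_E_add hE _ _ i1 i2.
rewrite -/(bad q m k); lra.
Qed.

Lemma measurable_bad q m k : measurable [set w | 1 <= bad q m k w].
Proof.
have mI s j : measurable_fun setT (fun w => incr s w j).
  apply: measurable_funM; first exact: measurable_cst.
  apply: measurable_funB; last exact: measurable_cst.
  by apply: measurable_funM; [exact: measurable_cst|exact: measurable_clamp].
have mB : measurable_fun setT (bad q m k).
  apply: measurable_funD.
    by apply: measurable_funD; apply: measurable_lyap => j; exact: mI.
  apply: measurable_sum => j; apply: measurable_funM; first exact: measurable_cst.
  exact: measurable_funX.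
have -> : [set w | 1 <= bad q m k w] = setT `&` bad q m k @^-1` `[1, +oo[%classic.
  by rewrite setTI; apply/seteqP; split=> w /=; rewrite in_itv /= andbT.
by apply: mB => //; exact: measurable_itv.
Qed.

(** No clamping occurs at [w], so [eta] exceeds [incr] by at most [v] at each step; the clamped walk
    stays below [2 / q] by [lyap_lt1]. *)
Lemma refl_le_of_bad_lt1 (s q : R) m k l w : (s = 1) \/ (s = - 1) -> 0 < q ->
  bad q m k w < 1 -> (l <= k)%N ->
  refl (eta s w) m l <= 2 / q + \sum_(j < k) v (m + j)%N.
Proof.
move=> hs q0 bad1 lk.
have sq0 j : 0 <= (b (m + j)%N ^+ 2)^-1 * X (m + j)%N w ^+ 2.
  by rewrite mulr_ge0 ?invr_ge0 ?sqr_ge0.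
have l1 := lyap_ge0 q (incr 1 w) m k.
have l2 := lyap_ge0 q (incr (- 1) w) m k.
(* All the terms of [bad] are non-negative, so each single square is below 1. *)
have Xb j : (j < k)%N -> `|X (m + j)%N w| <= b (m + j)%N.
  move=> jk; have : (b (m + j)%N ^+ 2)^-1 * X (m + j)%N w ^+ 2 < 1.
    apply: le_lt_trans bad1; rewrite /bad (bigD1 (Ordinal jk)) //=.
    rewrite addrCA lerDl; apply: addr_ge0; first exact: addr_ge0.
    by apply: sumr_ge0 => i _; exact: sq0.
  rewrite mulrC ltr_pdivrMr ?exprn_gt0 // mul1r -[X _ w ^+ 2]real_normK ?num_real //.
  by rewrite ltr_sqr ?nnegrE ?(ltW (b0 _)) // => /ltW.
have lyap1 : lyap q (incr s w) m k < 1.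
  have := sumr_ge0 (index_enum 'I_k) (fun j (_ : true) => sq0 j).
  by move: bad1; rewrite /bad; case: hs => ->; lra.
have s1 : `|s| <= 1 by case: hs => ->.
apply: (@le_trans _ _ (refl (fun j => incr s w j + v j) m l)).
  apply: refl_le => j /andP[mj jl]; rewrite -(subnKC mj).
  apply: (std_clampE hE) => //; apply: Xb.
  by rewrite ltn_subLR //; apply: leq_trans jl _; rewrite leq_add2l.
apply: le_trans (refl_addr_le _ _ _ _ v0) _; apply: lerD.
  by rewrite ler_pdivlMr // mulrC ltW // (lyap_lt1 _ _ _ k).
by rewrite -(subnKC lk) big_split_ord /= lerDl sumr_ge0.
Qed.

(** The terms before [m] form a fixed number [C], absorbed as [b n] grows; the others are bounded by
    [b n] times the reflected walk. Each part costs [eps]. *)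
Lemma centered_partial_sum_le (eps : R) (s : R) w (m : nat) :
  `|s| <= 1 -> 0 < eps -> (forall l, refl (eta s w) m l <= eps) ->
  exists N, forall n, (N <= n)%N ->
    (\sum_(j < n.+1) s * X j w - e (fun w => \sum_(j < n.+1) s * X j w)) / b n <=
    2 * eps.
Proof.
move=> s1 eps0 hm.
pose C := \sum_(j < m) (s * X j w - e (fun w => s * X j w)).
have [N hN] := bcvg (`|C| / eps); exists (maxn N m) => n.
rewrite geq_max => /andP[Nn mn].
rewrite ler_pdivrMr //.
have CN : C <= eps * b n.
  apply: le_trans (ler_norm _) _.
  by have := hN n Nn; rewrite ler_pdivrMr // mulrC.
have le1 : \sum_(j < n.+1) s * X j w - e (fun w => \sum_(j < n.+1) s * X j w) <=
    \sum_(j < n.+1) (s * X j w - e (fun w => s * X j w)).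
  rewrite sumrB lerD2l lerN2; exact: (sum_fine_E_le hE HX hind).
apply: le_trans le1 _.
have -> : \sum_(j < n.+1) (s * X j w - e (fun w => s * X j w)) =
    C + \sum_(j < (n - m).+1) b (m + j)%N * eta s w (m + j)%N.
  have -> : n.+1 = (m + (n - m).+1)%N by rewrite addnS subnKC.
  rewrite big_split_ord /=; congr (_ + _); apply: eq_bigr => j _.
  by rewrite /eta mulVKf ?gt_eqF.
have le2 := weighted_sum_le_refl b (eta s w) m (n - m) (fun j => ltW (b0 j)) bmono.
rewrite subnKC // in le2.
have le3 : b n * refl (eta s w) m (n - m).+1 <= b n * eps by rewrite ler_wpM2l ?(ltW (b0 n)).
lra.
Qed.

(** Block [i] runs from [start i] to [start i.+1]. Off its bad set a walk restarted at [start i]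
    stays below [2 * 2^-i], and these bounds sum to [4 * 2^-K] over all blocks from [K] on. *)
Lemma bad_blocks_exist : exists D : nat -> set Omega,
  [/\ forall i, measurable (D i),
      forall i, (Vhat H E (D i) <= ((2^-1 : R) ^+ i)%:E)%E &
      forall w K s, (s = 1) \/ (s = - 1) -> (forall i, ~ D (K + i)%N w) ->
        exists m, forall l, refl (eta s w) m l <= 4 * 2^-1 ^+ K].
Proof.
pose p i : R := 2^-1 ^+ i.
have p0 i : 0 < p i by rewrite exprn_gt0 // invr_gt0.
have pS i : p i.+1 = 2^-1 * p i by rewrite /p exprS.
(* Makes the exceedance level [2 / q i] equal to [p i]. *)
pose q i : R := 2 / p i.
have q0 i : 0 < q i by rewrite divr_gt0.
(* The factor in [Vhat_bad_le]: block variance at most [p i / c i] gives capacity at most [p i]. *)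
pose c i : R := 8 * q i ^+ 2 + 1.
have c1 i : 1 <= c i by rewrite lerDr mulr_ge0 // sqr_ge0.
have c0 i : 0 < c i by exact: lt_le_trans (c1 i).
have /choice[N hN] : forall i, exists N, forall m k, (N <= m)%N ->
    \sum_(j < k) v (m + j)%N <= p i / c i.
  by move=> i; apply: v_tail; exact: divr_gt0.
have [start [startS start_ge start_grow]] : exists start : nat -> nat,
    [/\ forall i, start i.+1 = (start i + (N i.+1).+1)%N,
        forall i, (N i <= start i)%N &
        forall K i, (start K + i <= start (K + i)%N)%N].
  (* The successor makes every block non-empty, so that the starts tend to infinity even if some
     [N l] vanish. *)
  exists (fun i => \sum_(l < i.+1) (N l).+1)%N.
  have S i : (\sum_(l < i.+2) (N l).+1 = \sum_(l < i.+1) (N l).+1 + (N i.+1).+1)%N.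
    by rewrite big_ord_recr.
  split=> // [i|K i].
    by rewrite big_ord_recr /=; apply: leq_trans (leqnSn _) (leq_addl _ _).
  elim: i => [|i IH]; first by rewrite !addn0.
  by rewrite !addnS S; lia.
pose D i := [set w | 1 <= bad (q i) (start i) (N i.+1).+1 w].
exists D; split=> [i|i|w K s hs hD]; first exact: measurable_bad.
  apply: le_trans (Vhat_bad_le _ _ _ (ltW (q0 i))) _.
  rewrite lee_fin -/(c i) mulrC -ler_pdivlMr //; exact: hN.
exists (start K).
have block i l : (l <= (N (K + i).+1).+1)%N ->
    refl (eta s w) (start (K + i)%N) l <= 2 * p (K + i)%N.
  move=> lN; have nbad : bad (q (K + i)%N) (start (K + i)%N) (N (K + i).+1).+1 w < 1.
    by rewrite ltNge; apply/negP; exact: hD.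
  apply: le_trans (refl_le_of_bad_lt1 _ _ _ _ _ _ hs (q0 _) nbad lN) _.
  have -> : 2 / q (K + i)%N = p (K + i)%N by rewrite /q invf_div mulrC divfK.
  have : p (K + i)%N / c (K + i)%N <= p (K + i)%N.
    by rewrite ler_pdivrMr // ler_peMr // ltW.
  have := hN (K + i)%N (start (K + i)%N) (N (K + i).+1).+1 (start_ge _); lra.
(* The bound is the closed form of the sum of [2 * p (K + j)] over [j < i]. *)
have main i : forall l, (start K + l <= start (K + i)%N)%N ->
    refl (eta s w) (start K) l <= 4 * p K - 4 * p (K + i)%N.
  elim: i => [|i IH] l; rewrite ?addn0 ?addnS ?startS => hl.
    have -> : l = 0%N by lia.
    by rewrite /= subrr.
  rewrite pS; have := p0 (K + i)%N.
  have [hle|hlt] := leqP (start K + l) (start (K + i)%N).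
    by have := IH l hle; lra.
  have hK : (start K <= start (K + i)%N)%N by apply: leq_trans (start_grow K i); exact: leq_addr.
  (* Split the walk at the start of the last block: induction covers the part before, [block] the
     part after. *)
  have -> : l = ((start (K + i)%N - start K) + (start K + l - start (K + i)%N))%N by lia.
  have := refl_restart (eta s w) (start K) (start (K + i)%N - start K)
    (start K + l - start (K + i)%N).
  rewrite subnKC //.
  have := block i (start K + l - start (K + i)%N)%N ltac:(lia).
  have := IH (start (K + i)%N - start K)%N ltac:(lia).
  lra.
move=> l; apply: le_trans (main l l (start_grow K l)) _.
by rewrite gerBl mulr_ge0 // ltW.
Qed.

Lemma Vstar_centered_limsup_eq0 (A : set Omega) :
  (forall w, A w -> exists2 s : R, (s = 1) \/ (s = - 1) &
    ~ (forall eps : R, 0 < eps -> exists N, forall n, (N <= n)%N ->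
      (\sum_(j < n.+1) s * X j w - e (fun w => \sum_(j < n.+1) s * X j w)) / b n <= eps)) ->
  Vstar H E A = 0%E.
Proof.
move=> hA; have [D [mD VD hD]] := bad_blocks_exist.
apply: (Vstar_limsup_eq0 hE _ _ mD VD) => K w /hA[s hs]; apply: contra_notP => nD eps eps0.
have s1 : `|s| <= 1 by case: hs => ->.
(* Avoiding the tail from [K] on means avoiding it from [K + K'] on. Then
   [4 * 2^-(K + K') <= eps / 2], which [centered_partial_sum_le] doubles to [eps]. *)
have [K' hK'] := half_pow_le (eps / 8) ltac:(by rewrite divr_gt0).
have nD' i : ~ D (K + K' + i)%N w.
  by move=> Dw; apply: nD; exists (K' + i)%N => //; rewrite addnA.
have [m hm] := hD w (K + K')%N s hs nD'.
have [|N hN] := centered_partial_sum_le (eps / 2) s w m s1 ltac:(by rewrite divr_gt0).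
  move=> l; apply: le_trans (hm l) _.
  by have := hK' (K + K')%N (leq_addl _ _); lra.
by exists N => n Nn; have := hN n Nn; lra.
Qed.

End BlockArgument.

(** * Reduction of both limits to the signed block statement, after a shift of the index by one *)

Theorem theorem3p1 (R : realType) (d : measure_display) (Omega : measurableType d)
  (H : set (Omega -> R)) (E : (Omega -> R) -> \bar R)
  (hE : sublinear_expectation_space H E)
  (X : nat -> Omega -> R)
  (hXH : forall n : nat, (1 <= n)%N -> H (X n))
  (hXmeas : forall n : nat, (1 <= n)%N -> measurable_fun setT (X n))
  (hind : indep_seq E X)
  (a : nat -> R)
  (ha1 : forall n : nat, (1 <= n)%N -> 1 <= a n)
  (hamono : forall n m : nat, (1 <= n)%N -> (n <= m)%N -> a n <= a m)
  (hainf : a @ \oo --> +oo)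
  (hsum : (\sum_(1 <= n <oo) (E (fun w => (X n w ^+ 2)%R) * ((a n) ^+ 2)^-1%:E) < +oo)%E) :
  let S := fun (n : nat) (w : Omega) => \sum_(1 <= i < n.+1) X i w in
  Vstar H E
    [set w | (0 < limn_esup (fun n => ((S n w - fine (E (S n))) / a n)%:E))%E \/
             (limn_einf (fun n => ((S n w - fine (- E (fun w' => (- S n w')%R))%E) / a n)%:E) < 0)%E]
  = 0%E.
Proof.
move=> S.
have SE n : S n = fun w => \sum_(j < n) X j.+1 w.
  by apply/funext => w; rewrite /S big_add1 big_mkord.
have E0 n : (0 <= E (fun w => (X n.+1 w ^+ 2)%R))%E.
  have -> : 0%E = E (fun _ => 0) by rewrite (E_cst hE).
  apply: (E_le hE); first exact: (rv_cst hE); last by move=> w; exact: sqr_ge0.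
  by apply: (rv_sqr hE); exact: hXH.
pose u n := (E (fun w => (X n w ^+ 2)%R) * ((a n) ^+ 2)^-1%:E)%E.
have a2 n : 0 < (a n.+1 ^+ 2)^-1.
  by rewrite invr_gt0 exprn_gt0 // (lt_le_trans ltr01) // ha1.
have u0 n : (1 <= n)%N -> (0 <= u n)%E.
  by case: n => // n _; rewrite mule_ge0 // lee_fin ltW.
have partial k : (\sum_(1 <= n < k) u n < +oo)%E.
  apply: le_lt_trans hsum; apply: (nneseries_lim_ge (u_ := u) (P := xpredT)) => n n1 _.
  exact: u0.
(* An infinite second moment would make one term, hence a partial sum of the non-negative series,
   infinite. *)
have fX2 n : (E (fun w => (X n.+1 w ^+ 2)%R) < +oo)%E.
  rewrite ltey; apply/eqP => Einf; have := partial n.+2.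
  rewrite big_nat_recr //= {2}/u Einf gt0_mulye ?lte_fin // addey //.
  rewrite -ltNye; apply: (@lt_le_trans _ _ 0%E) => //.
  by rewrite big_nat_cond; apply: sume_ge0 => i; rewrite andbT => /andP[? _]; exact: u0.
pose v j := fine (E (fun w => (X j.+1 w ^+ 2)%R)) / a j.+1 ^+ 2.
have uv j : u j.+1 = (v j)%:E.
  rewrite /u /v EFinM fineK // ge0_fin_numE //.
have v0 j : 0 <= v j by rewrite -lee_fin -uv u0.
pose T := fine (\sum_(1 <= n <oo) u n)%E.
have vT n : \sum_(j < n) v j <= T.
  rewrite -lee_fin /T fineK; last first.
    by rewrite ge0_fin_numE //; apply: nneseries_ge0 => k k1 _; exact: u0.
  apply: le_trans (nneseries_lim_ge (u_ := u) (P := xpredT) n.+1 _); last first.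
    by move=> k k1 _; exact: u0.
  rewrite big_add1 big_mkord -sumEFin le_eqVlt; apply/orP; left; apply/eqP.
  by apply: eq_bigr => j _; rewrite uv.
have bcvg (A : R) : exists N, forall n, (N <= n)%N -> A <= a n.+1.
  have /cvgryPge/(_ A)[N _ hN] := hainf.
  by exists N => n Nn; apply: hN => /=; exact: leqW.
apply: (Vstar_centered_limsup_eq0 hE (X := fun j => X j.+1) (b := fun j => a j.+1)) => //.
- by move=> j; exact: hXH.
- by move=> j; exact: hXmeas.
- by move=> j; exact: ha1.
- by move=> i j ij; exact: hamono.
- exact: bounded_sum_tail vT.
move=> w [hw|hw].
  exists 1; first by left.
  move=> h; suff : (limn_esup (fun n => ((S n w - fine (E (S n))) / a n)%:E) <= 0)%E.
    by rewrite leNgt hw.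
  apply: limn_esup_le0 => eps eps0; have [N hN] := h eps eps0.
  (* Starting at [N.+1] excludes index 0; [S n.+1] is then paired with [b n = a n.+1]. *)
  exists N.+1 => -[//|n]; rewrite ltnS => Nn; rewrite SE.
  have := hN n Nn; congr (_ <= _); congr ((_ - fine (E _)) / _).
    by apply: eq_bigr => j _; rewrite mul1r.
  by apply/funext => w'; apply: eq_bigr => j _; rewrite mul1r.
exists (- 1); first by right.
(* Minus the lower limit is the upper limit for [-X], because [S] minus its lower expectation is the
   negative of [-S - E (-S)]. *)
move=> h; move: hw; apply/negP; rewrite -leNgt -oppe_le0 -limn_esupN.
apply: limn_esup_le0 => eps eps0; have [N hN] := h eps eps0.
exists N.+1 => -[//|n]; rewrite ltnS => Nn; rewrite SE.
have := hN n Nn; congr (_ <= _).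
have NS w' : \sum_(j < n.+1) - 1 * X j.+1 w' = - \sum_(j < n.+1) X j.+1 w'.
  by rewrite -sumrN; apply: eq_bigr => j _; rewrite mulN1r.
rewrite (funext NS).
by rewrite NS fineN opprK -mulNr opprD.
Qed.
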